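(* Let $0<p<1$, let $d\ge2$ be an integer, and let $f,g:\{0,1\}^n\to\{0,1\}$ satisfy \[ \sum_{j=1}^nI'_j(f)^2\le1,\qquad\sum_{j=1}^nI'_j(g)^2\le1,\qquad\sum_{j=1}^nI'_j(f)I'_j(g)\le\exp(-2(d-1)). \] Then \[ \sum_{|S|=d}\hat f(S)\hat g(S)\le\frac{70e}{d}\left(\frac{4B(p)e}{d-1}\right)^{d-1}\Big(\sum_{j=1}^nI'_j(f)I'_j(g)\Big)\left(\log\frac{d}{\sum_{j=1}^nI'_j(f)I'_j(g)}\right)^{d-1}. \]
   Context: $\{0,1\}^n$ carries the product measure $\mu(x)=\prod_ip^{x_i}(1-p)^{1-x_i}$, $\langle g,h\rangle=\mathbb{E}_\mu[gh]$. Let $\omega_i(x)=\sqrt{(1-p)/p}$ if $x_i=1$, $-\sqrt{p/(1-p)}$ if $x_i=0$, $\omega_T=\prod_{i\in T}\omega_i$, and $\hat f(T)=\langle f,\omega_T\rangle$. The influence is $I_i(f)=\Pr_{x\sim\mu}[f(x)\ne f(x\oplus e_i)]$ ($x\oplus e_i$: coordinate $i$ flipped), and $I'_i(f)=\sqrt{p(1-p)}\,I_i(f)$. $B(p)=\frac{(1-p)-p}{2p(1-p)(\ln(1-p)-\ln p)}$ (with $B(1/2)=1$). $\log$ is the natural logarithm. *)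

(* Defs.v *)
From HB Require Import structures.
From mathcomp Require Import all_boot all_order all_algebra.
From mathcomp Require Import reals sequences exp.

Set Implicit Arguments.
Unset Strict Implicit.
Unset Printing Implicit Defensive.

Import Order.TTheory GRing.Theory Num.Theory.
Local Open Scope ring_scope.

Definition cube (n : nat) := {ffun 'I_n -> bool}.

Definition pmeas (R : realType) (p : R) (n : nat) (x : cube n) : R :=
  \prod_(i < n) (p ^+ (x i : nat) * (1 - p) ^+ (1 - x i)%N).

Definition expect (R : realType) (p : R) (n : nat) (h : cube n -> R) : R :=
  \sum_(x : cube n) pmeas p x * h x.

Definition prob (R : realType) (p : R) (n : nat) (A : pred (cube n)) : R :=
  \sum_(x : cube n | A x) pmeas p x.

Definition inner (R : realType) (p : R) (n : nat) (g h : cube n -> R) : R :=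
  expect p (fun x => g x * h x).

Definition omega1 (R : realType) (p : R) (n : nat) (i : 'I_n) (x : cube n) : R :=
  if x i then Num.sqrt ((1 - p) / p) else - Num.sqrt (p / (1 - p)).

Definition omega (R : realType) (p : R) (n : nat) (T : {set 'I_n})
    (x : cube n) : R :=
  \prod_(i in T) omega1 p i x.

Definition fourier (R : realType) (p : R) (n : nat) (f : cube n -> bool)
    (T : {set 'I_n}) : R :=
  inner p (fun x => (f x)%:R) (omega p T).

Definition flip (n : nat) (i : 'I_n) (x : cube n) : cube n :=
  [ffun j => if j == i then ~~ x j else x j].

Definition influence (R : realType) (p : R) (n : nat) (f : cube n -> bool)
    (i : 'I_n) : R :=
  prob p (fun x => f x != f (flip i x)).

Definition influence' (R : realType) (p : R) (n : nat) (f : cube n -> bool)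
    (i : 'I_n) : R :=
  Num.sqrt (p * (1 - p)) * influence p f i.

Definition Bconst (R : realType) (p : R) : R :=
  if p == 2^-1 then 1
  else ((1 - p) - p) / (2 * p * (1 - p) * (ln (1 - p) - ln p)).

(* Main.v *)
(** Put [k = d - 1].  Choose a random set [I] containing each coordinate with
    probability [1/d]; a set [S] of size [d] meets [I] in exactly one point with
    probability [(1 - 1/d)^(d-1) >= 1/e], so it suffices to bound the average over
    [I] of the sum over [i] in [I] of the level-[k] correlations of the functions
    [F_i = E[f omega_i | coordinates outside I]] and of their analogues for [g].
    Here [E|F_i| <= I'_i(f)], and, since the sets [{i} u T], for [i] in [I] and
    [T] disjoint from [I], are distinct, the [E F_i^2] add up to at most [1].

    Hypercontractivity on degree [k] for the even exponent [2m], with constant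
    [C = 2B(p)(2m-1)], and Hölder's inequality give
    [|<F_i, G_i>_k|^m <= C^(km) (I'_i(f) I'_i(g))^(m-1) (E F_i^2 + E G_i^2)/2].
    Applying Hölder once more, over the pairs [(I, i)], bounds the average by
    [C^k (W/d)^(1-1/m)], where [W] is the sum of the [I'_j(f) I'_j(g)], and one
    takes [2m] to be an even integer nearest to [2 log(d/W) / k].

    The one-variable hypercontractive inequality is proved by symmetrization,
    which reduces it to [2pq L^j <= (2j-1)!!], where [q = 1 - p] and
    [L = log(q/p)/(q - p) = 1/(2pq B(p))]. *)

Require Import Defs.
From HB Require Import structures.
From mathcomp Require Import all_boot all_order all_algebra.
From mathcomp Require Import reals sequences exp.
From mathcomp Require Import ring lra zify.

Set Implicit Arguments.
Unset Strict Implicit.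
Unset Printing Implicit Defensive.

Import Order.TTheory GRing.Theory Num.Theory.
Local Open Scope ring_scope.

(** * Hölder-type inequalities for finite sums, with integer exponents *)

Lemma ler_of_expr (F : realDomainType) (N : nat) (x y : F) :
  (0 < N)%N -> 0 <= y -> x ^+ N <= y ^+ N -> x <= y.
Proof.
move=> N0 y0 xy; have [x0|/ltW x0] := leP 0 x; last exact: le_trans y0.
by rewrite -(ler_pXn2r N0).
Qed.

(** Divide each [A j] by its sum and let [T] be the mean of the resulting distributions, so that [T]
    sums to 1; AM-GM bounds [X i ^+ N] by the product of the sums times [T i ^+ N]. Keeping the N-th
    powers avoids roots, so any real field will do. *)
Lemma generalized_holder (F : realFieldType) (I : finType) (N : nat)
    (X : I -> F) (A : 'I_N -> I -> F) :
  (0 < N)%N -> (forall i, 0 <= X i) -> (forall j i, 0 <= A j i) ->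
  (forall i, X i ^+ N <= \prod_(j < N) A j i) ->
  (\sum_i X i) ^+ N <= \prod_(j < N) \sum_i A j i.
Proof.
move=> N0 X0 A0 XA.
pose S j := \sum_i A j i.
have S0 j : 0 <= S j by apply: sumr_ge0.
have [/existsP[j /eqP Sj]|/existsPn Sn] := boolP [exists j, S j == 0].
  rewrite [\sum_i X i]big1 ?expr0n.
    by rewrite (gtn_eqF N0) /= prodr_ge0 // => l _; exact: S0.
  move=> i _; apply/eqP.
  have : X i ^+ N == 0.
    rewrite eq_le exprn_ge0 // andbT (le_trans (XA i)) // (bigD1 j) //=.
    suff -> : A j i = 0 by rewrite mul0r.
    apply/eqP; rewrite eq_le A0 andbT -Sj /S (bigD1 i) //=.
    by rewrite lerDl sumr_ge0.
  by rewrite expf_eq0 N0.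
have {Sn} Sp j : 0 < S j by rewrite lt_def Sn S0.
have P0 : 0 < \prod_j S j by apply: prodr_gt0.
pose T i := (\sum_j A j i / S j) / N%:R.
have T0 i : 0 <= T i.
  by rewrite divr_ge0 // sumr_ge0 // => j _; rewrite divr_ge0 // ltW.
have AG i : X i ^+ N <= (\prod_j S j) * T i ^+ N.
  apply: (le_trans (XA i)).
  have -> : \prod_j A j i = (\prod_j S j) * \prod_j (A j i / S j).
    rewrite -big_split /=; apply: eq_bigr => j _.
    by rewrite mulrCA divff ?mulr1 // gt_eqF.
  rewrite ler_pM2l //.
  have := leif_AGM (F := F) (A := predT) (E := fun j : 'I_N => A j i / S j).
  rewrite card_ord => h; apply: h => j _.
  by rewrite divr_ge0 // ltW.
have ST : \sum_i T i = 1.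
  rewrite -mulr_suml exchange_big /=.
  rewrite (eq_bigr (fun=> 1)) => [|j _]; last first.
    by rewrite -mulr_suml divff // gt_eqF //; exact: Sp.
  by rewrite sumr_const card_ord divff // pnatr_eq0 -lt0n.
(* If [s ^+ N] exceeded the product of the sums, then [X i <= s * T i] everywhere, strictly where
   [T i > 0]; summation would give [s < s]. *)
rewrite leNgt; apply/negP => lt; pose s := \sum_i X i.
have s0 : 0 <= s by apply: sumr_ge0.
have XT i : X i <= s * T i.
  apply: (ler_of_expr N0); first by rewrite mulr_ge0.
  rewrite exprMn (le_trans (AG i)) //.
  by rewrite ler_wpM2r ?exprn_ge0 // ltW.
have [i Ti] : exists i, 0 < T i.
  have [/existsP //|/existsPn h] := boolP [exists i, 0 < T i].
  have := ST; rewrite big1 => [/esym/eqP|i _]; first by rewrite oner_eq0.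
  by have := h i; rewrite lt_def T0 andbT negbK => /eqP.
have XTi : X i < s * T i.
  rewrite ltNge; apply/negP => le.
  have : (s * T i) ^+ N <= X i ^+ N.
    by apply: lerXn2r => //; rewrite nnegrE; [exact: mulr_ge0|exact: X0].
  apply/negP; rewrite -ltNge exprMn (le_lt_trans (AG i)) //.
  by rewrite ltr_pM2r ?exprn_gt0.
suff : s < s * \sum_i T i by rewrite ST mulr1 ltxx.
rewrite mulr_sumr [ltLHS](bigD1 i) //= [ltRHS](bigD1 i) //=.
by apply: ltr_leD => //; apply: ler_sum.
Qed.

Lemma jensen_pow (F : realFieldType) (I : finType) (w a : I -> F) (N : nat) :
  (forall i, 0 <= w i) -> \sum_i w i = 1 ->
  (\sum_i w i * `|a i|) ^+ N.+1 <= \sum_i w i * `|a i| ^+ N.+1.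
Proof.
move=> w0 w1.
pose A (j : 'I_N.+1) i := if j == ord0 then w i * `|a i| ^+ N.+1 else w i.
have := @generalized_holder F I N.+1 (fun i => w i * `|a i|) A isT.
rewrite big_ord_recl /= [X in _ * X]big1 => [|j _]; last by rewrite /A /= w1.
rewrite mulr1; apply.
- by move=> i; rewrite mulr_ge0.
- by move=> j i; rewrite /A; case: ifP => _ //; rewrite mulr_ge0 // exprn_ge0.
- move=> i; rewrite big_ord_recl /A /= prodr_const card_ord exprMn exprS.
  by rewrite mulrAC.
Qed.

(** Hölder with m - j copies of [w i * U i ^+ m] and j copies of [w i * V i ^+ m]. It controls the
    mixed terms of a binomial expansion. *)
Lemma holder_mix (F : realFieldType) (I : finType) (w U V : I -> F)
    (m j : nat) (a b : F) :
  (0 < m)%N -> (j <= m)%N -> (forall i, 0 <= w i) ->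
  (forall i, 0 <= U i) -> (forall i, 0 <= V i) -> 0 <= a -> 0 <= b ->
  \sum_i w i * U i ^+ m <= a ^+ m -> \sum_i w i * V i ^+ m <= b ^+ m ->
  \sum_i w i * (U i ^+ (m - j) * V i ^+ j) <= a ^+ (m - j) * b ^+ j.
Proof.
move=> m0 jm w0 U0 V0 a0 b0 Ua Vb.
pose A (l : 'I_m) i := w i * (if (l < j)%N then V i else U i) ^+ m.
have prodA (x y : F) : \prod_(l < m) (if (l < j)%N then y else x) =
    x ^+ (m - j) * y ^+ j.
  rewrite -(big_mkord predT (fun l => if (l < j)%N then y else x)).
  rewrite (big_cat_nat (n := j)) //= mulrC; congr (_ * _).
    rewrite big_nat_cond (eq_bigr (fun=> x)); last first.
      by move=> l /andP[/andP[jl _] _]; rewrite ltnNge jl.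
    by rewrite -big_nat_cond prodr_const_nat.
  rewrite big_nat_cond (eq_bigr (fun=> y)); last by move=> l /andP[/andP[_ ->]].
  by rewrite -big_nat_cond prodr_const_nat subn0.
apply: (ler_of_expr m0); first by rewrite mulr_ge0 ?exprn_ge0.
apply: (@le_trans _ _ (\prod_(l < m) \sum_i A l i)).
  apply: generalized_holder => // [i|l i|i].
  - by rewrite mulr_ge0 // mulr_ge0 ?exprn_ge0.
  - by rewrite mulr_ge0 // exprn_ge0 //; case: ifP.
  - rewrite /A big_split /= prodr_const card_ord prodrXl prodA exprMn.
    by rewrite lexx.
apply: (@le_trans _ _ (\prod_(l < m) (if (l < j)%N then b ^+ m else a ^+ m))).
  apply: ler_prod => l _; rewrite sumr_ge0 => [|i _]; last first.
    by rewrite mulr_ge0 // exprn_ge0 //; case: ifP.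
  by rewrite /A; case: ifP.
by rewrite prodA exprMn -!exprM !(mulnC m).
Qed.

Lemma lyapunov_holder (F : realFieldType) (I : finType) (w U H : I -> F)
    (m : nat) :
  (0 < m)%N -> (forall i, 0 <= w i) ->
  (\sum_i w i * (`|U i| * `|H i|)) ^+ (2 * m) <=
  (\sum_i w i * `|U i|) ^+ (2 * m - 2) * (\sum_i w i * U i ^+ 2) *
  \sum_i w i * H i ^+ (2 * m).
Proof.
case: m => // m _ w0; rewrite (_ : (2 * m.+1 = (2 * m).+2)%N); last by lia.
pose A (l : 'I_(2 * m).+2) i := w i * (if l == 0%N :> nat then U i ^+ 2 else
   if l == 1%N :> nat then H i ^+ (2 * m).+2 else `|U i|).
have sq i : 0 <= H i ^+ (2 * m).+2.
  by rewrite (_ : _.+2 = m.+1 * 2)%N ?exprM ?sqr_ge0 //; lia.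
rewrite subn2 /=.
have -> : (\sum_i w i * `|U i|) ^+ (2 * m) * (\sum_i w i * U i ^+ 2) *
    \sum_i w i * H i ^+ (2 * m).+2 = \prod_l \sum_i A l i.
  rewrite 2!big_ord_recl /= [X in _ = _ * (_ * X)](eq_bigr (fun=>
    \sum_i w i * `|U i|)) // prodr_const card_ord /A /=.
  by rewrite -mulrA mulrC mulrA.
apply: generalized_holder => // [i|l i|i].
- by rewrite mulr_ge0 // mulr_ge0.
- rewrite mulr_ge0 //; case: ifP => _; first exact: sqr_ge0.
  by case: ifP.
- rewrite 2!big_ord_recl /A /= prodr_const card_ord !exprMn.
  rewrite -[`|H i| ^+ _]normrX (ger0_norm (sq i)).
  rewrite -(real_normK (num_real (U i))) !exprS !expr0 le_eqVlt; apply/orP; left.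
  by apply/eqP; ring.
Qed.

(** The triangle inequality in L^m without roots: [a] and [b] stand for upper bounds on the norms.
    Expand both sides and apply [holder_mix] to each binomial term. *)
Lemma minkowski_pow (F : realFieldType) (I : finType) (w U V : I -> F)
    (m : nat) (a b : F) :
  (0 < m)%N -> (forall i, 0 <= w i) ->
  (forall i, 0 <= U i) -> (forall i, 0 <= V i) -> 0 <= a -> 0 <= b ->
  \sum_i w i * U i ^+ m <= a ^+ m -> \sum_i w i * V i ^+ m <= b ^+ m ->
  \sum_i w i * (U i + V i) ^+ m <= (a + b) ^+ m.
Proof.
move=> m0 w0 U0 V0 a0 b0 Ua Vb; rewrite exprDn.
under eq_bigr => i _ do rewrite exprDn mulr_sumr.
rewrite exchange_big /=; apply: ler_sum => j _.
under eq_bigr => i _ do rewrite mulrnAr.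
rewrite sumrMnl lerMn2r; apply/orP; right.
by apply: holder_mix => //; rewrite -ltnS.
Qed.

Lemma cauchy_schwarz_sum (F : realFieldType) (I : finType) (a b : I -> F) :
  (\sum_i a i * b i) ^+ 2 <= (\sum_i a i ^+ 2) * \sum_i b i ^+ 2.
Proof.
pose A (j : 'I_2) i := if j == ord0 then a i ^+ 2 else b i ^+ 2.
have h := @generalized_holder F I 2 (fun i => `|a i * b i|) A isT.
rewrite 2!big_ord_recl big_ord0 mulr1 /A /= in h.
apply: le_trans (h _ _ _); last 3 first.
- by [].
- by move=> j i; case: ifP => _; exact: sqr_ge0.
- move=> i; rewrite 2!big_ord_recl big_ord0 mulr1 /=.
  by rewrite real_normK ?num_real // exprMn.
rewrite -real_normK ?num_real //; apply: lerXn2r; rewrite ?nnegrE ?sumr_ge0 //.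
exact: ler_norm_sum.
Qed.

(** * Double factorials, exponential estimates and the bound 2pq L^j <= (2j-1)!! *)

(** The double factorial (2j-1)!!, which is the 2j-th moment of a standard Gaussian. *)
Definition odd_fact (j : nat) : nat := \prod_(l < j) (2 * l + 1)%N.

Lemma odd_factS j : odd_fact j.+1 = (odd_fact j * (2 * j + 1))%N.
Proof. by rewrite /odd_fact big_ord_recr. Qed.

Lemma odd_fact1 : odd_fact 1 = 1%N.
Proof. by rewrite /odd_fact big_ord_recr big_ord0. Qed.

Section ExpBounds.
Variable R : realType.
Implicit Types x : R.

Lemma series_exp_coeff_le_expR x n :
  0 <= x -> \sum_(i < n) x ^+ i / i`!%:R <= expR x.
Proof.
move=> x0; rewrite -(big_mkord predT (fun i => x ^+ i / i`!%:R)).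
apply: (@nondecreasing_cvgn_le R (series (exp_coeff x))).
- by apply: nondecreasing_series => k _ _; exact: exp_coeff_ge0.
- exact: is_cvg_series_exp_coeff.
Qed.

Lemma expR_ge_quadratic x : 0 <= x -> 1 + x + x ^+ 2 / 2 <= expR x.
Proof.
move=> x0; apply: le_trans (series_exp_coeff_le_expR 3 x0).
by rewrite !big_ord_recr big_ord0 /= !factS fact0; lra.
Qed.

Lemma expR1_ge : 8 / 3 <= expR 1 :> R.
Proof.
apply: le_trans (series_exp_coeff_le_expR 4 ler01).
by rewrite !big_ord_recr big_ord0 /= !factS fact0 !expr1n; lra.
Qed.

Lemma expR_sub_ge x : 0 <= x -> 2 * x <= expR x - expR (- x).
Proof.
move=> x0; have h := expR_ge_quadratic x0.
have e0 := expR_gt0 x.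
have : expR (- x) <= 1 - x + x ^+ 2 / 2.
  rewrite expRN -div1r ler_pdivrMr //.
  have q0 : 0 <= 1 - x + x ^+ 2 / 2 by nra.
  (* (1 - x + x^2/2)(1 + x + x^2/2) = 1 + x^4/4. *)
  apply: le_trans (ler_wpM2l q0 h).
  have := exprn_even_ge0 x (isT : ~~ odd 4); nra.
by lra.
Qed.

(** The n-th power of e t <= e^t at t = x/n. *)
Lemma expr_div_le_expR n x :
  (0 < n)%N -> 0 <= x -> (expR 1 * x / n%:R) ^+ n <= expR x.
Proof.
move=> n0 x0.
have nR : 0 < n%:R :> R by rewrite ltr0n.
have -> : expR x = expR (x / n%:R) ^+ n.
  by rewrite -expRM_natl mulrC divfK // gt_eqF.
apply: lerXn2r; rewrite ?nnegrE ?expR_ge0 //.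
  by rewrite divr_ge0 ?mulr_ge0 ?expR_ge0 // ltW.
have -> : expR (x / n%:R) = expR 1 * expR (x / n%:R - 1).
  by rewrite -expRD; congr expR; lra.
rewrite -mulrA ler_pM2l ?expR_gt0 //.
by apply: le_trans (expR_ge1Dx _); lra.
Qed.

Lemma succ_expr_le n : (n.+1%:R ^+ n : R) <= expR 1 * n%:R ^+ n.
Proof.
case: n => [|n]; first by rewrite !expr0 mulr1; have := expR1_ge; lra.
have nR : 0 < n.+1%:R :> R by rewrite ltr0n.
rewrite -ler_pdivrMr ?exprn_gt0 // -expr_div_n.
have -> : expR 1 = expR n.+1%:R^-1 ^+ n.+1 :> R.
  by rewrite -expRM_natl divff ?gt_eqF.
apply: lerXn2r; rewrite ?nnegrE ?expR_ge0 //.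
  by rewrite divr_ge0 // ltW.
apply: le_trans (expR_ge1Dx _).
by rewrite -[n.+2]addn1 natrD mulrDl divff ?gt_eqF // mul1r.
Qed.

(** The case n = 2 amounts to e >= 8/3, the bound of [expR1_ge]. From n to n + 1 the left side grows
    by a factor at most e(n+1), by [succ_expr_le], and the right side by e(2n+1). *)
Lemma odd_fact_ge n : (2 <= n)%N ->
  2 * expR 1 * n%:R ^+ n <= expR 1 ^+ n * (odd_fact n)%:R :> R.
Proof.
have e0 := expR_gt0 (1 : R); have e83 := expR1_ge.
elim: n => // n IH; rewrite ltnS leq_eqVlt => /orP[/eqP<-|].
  by rewrite /odd_fact !big_ord_recr big_ord0 /= !muln1 !mul1n; nra.
move/IH => {}IH; rewrite odd_factS natrM natrD natrM.
apply: (@le_trans _ _ (2 * expR 1 * (n.+1%:R * (expR 1 * n%:R ^+ n)))).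
  rewrite exprS ler_pM2l; last by lra.
  by rewrite ler_pM2l ?ltr0n // succ_expr_le.
apply: (@le_trans _ _ (n.+1%:R * expR 1 * (expR 1 ^+ n * (odd_fact n)%:R))).
  rewrite (_ : 2 * _ * _ = n.+1%:R * expR 1 * (2 * expR 1 * n%:R ^+ n)); last by ring.
  by rewrite ler_pM2l // mulr_gt0 ?ltr0n.
have Z0 : 0 <= expR 1 * (expR 1 ^+ n * (odd_fact n)%:R) :> R.
  by rewrite !mulr_ge0 ?exprn_ge0 // ltW.
rewrite exprS; have := ler0n R n; rewrite -addn1 natrD; nra.
Qed.

(** Here [c] = log(q/p) and [l] = L = c/(1 - 2p). The case j = 1 is c <= sinh c. For larger j,
    either c is large enough that p is exponentially small in L, or L <= 3 and induction on j
    applies. *)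
Lemma log_mean_moment (p : R) j : 0 < p -> p < 2^-1 -> (0 < j)%N ->
  2 * p * (1 - p) * (ln ((1 - p) / p) / (1 - 2 * p)) ^+ j <= (odd_fact j)%:R.
Proof.
move=> p0 p2; set c := ln _; set l := c / _.
have r1 : 1 < (1 - p) / p by rewrite ltr_pdivlMr //; lra.
have ec : expR c = (1 - p) / p by rewrite /c lnK // posrE; lra.
have c0 : 0 < c by rewrite ln_gt0.
have q0 : 0 < 1 - 2 * p by lra.
have l0 : 0 < l by rewrite divr_gt0.
have lE : l * (1 - 2 * p) = c by rewrite divfK // gt_eqF.
have pE : p * expR c = 1 - p by rewrite ec mulrC divfK // gt_eqF.
have base : 2 * p * (1 - p) * l <= 1.
  have := expR_sub_ge (ltW c0); rewrite expRN ec invf_div => h.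
  have h2 : 2 * c * (p * (1 - p)) <= (1 - p) ^+ 2 - p ^+ 2.
    have -> : (1 - p) ^+ 2 - p ^+ 2 = ((1 - p) / p - p / (1 - p)) * (p * (1 - p)).
      by field; rewrite !gt_eqF //; lra.
    by rewrite ler_pM2r // mulr_gt0 //; lra.
  rewrite -(ler_pM2r q0) -[leLHS]mulrA lE; nra.
(* When 1 + 2c <= e^c, L <= c + 1, so 2pq <= 2e^(-c) <= 2e^(1-L). Since L^n <= e^L (n/e)^n <= e^L
   (2n-1)!!/(2e), the exponentials cancel. *)
case: (lerP (1 + 2 * c) (expR c)) => ce.
  have lc : l <= c + 1.
    rewrite -(ler_pM2r q0) lE; have : p * (1 + 2 * c) <= 1 - p; last by nra.
    by rewrite -pE ler_pM2l.
  case: j => // -[|n] _; first by rewrite expr1 odd_fact1.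
  have n2 : (2 <= n.+2)%N by [].
  move: (n.+2) n2 => {}n n2.
  have nR : 0 < n%:R :> R by rewrite ltr0n; lia.
  have h1 : 2 * p * (1 - p) <= 2 / expR c.
    rewrite ler_pdivlMr ?expR_gt0 //.
    rewrite (_ : _ * _ * _ * _ = 2 * (1 - p) * (p * expR c)); last by ring.
    by rewrite pE; nra.
  have h2 : expR l / expR 1 <= expR c.
    by rewrite -expRN -expRD ler_expR; lra.
  have h3 : l ^+ n * (2 * expR 1) <= (odd_fact n)%:R * expR l.
    have := expr_div_le_expR (ltnW n2) (ltW l0).
    rewrite expr_div_n exprMn ler_pdivrMr ?exprn_gt0 // => h3.
    have h4 := odd_fact_ge n2.
    rewrite -(ler_pM2r (exprn_gt0 n nR)) -mulrA.
    apply: (le_trans (ler_wpM2l (exprn_ge0 n (ltW l0)) h4)).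
    rewrite (_ : l ^+ n * _ = (odd_fact n)%:R * (expR 1 ^+ n * l ^+ n)); last ring.
    by rewrite -mulrA ler_wpM2l.
  apply: (@le_trans _ _ (2 / expR c * l ^+ n)).
    by rewrite ler_wpM2r // exprn_ge0 // ltW.
  rewrite mulrAC ler_pdivrMr ?expR_gt0 //.
  apply: (@le_trans _ _ ((odd_fact n)%:R * (expR l / expR 1))).
    by rewrite mulrA ler_pdivlMr ?expR_gt0 // -mulrA mulrCA.
  by rewrite ler_wpM2l.
(* Now e^c < 1 + 2c, and the quadratic lower bound for e^c forces c < 2. L <= 3 follows from (3 -
   c)(2 + c + c^2/2) = 6 + c(2 - c)(1 + c)/2 >= 6. Each new factor L is then at most 2j + 1 for j >=
   1. *)
have l3 : l <= 3.
  have := expR_ge_quadratic (ltW c0) => h.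
  have c2 : c < 2 by nra.
  rewrite -(ler_pM2r q0) lE.
  have : p * (1 + c + c ^+ 2 / 2) <= 1 - p by rewrite -pE ler_pM2l.
  have k1 : 6 <= (3 - c) * (2 + c + c ^+ 2 / 2).
    have : 0 <= c * ((2 - c) * (1 + c)) by rewrite !mulr_ge0 //; lra.
    by nra.
  move=> k2; have k3 : p * (2 + c + c ^+ 2 / 2) <= 1 by lra.
  have := ler_wpM2l (ltW p0) k1.
  have c3 : 0 <= 3 - c by lra.
  have := ler_wpM2l c3 k3; lra.
elim: j => // -[|j] IH _; first by rewrite expr1 odd_fact1.
rewrite odd_factS natrM exprSr mulrA ler_pM ?IH //.
- by rewrite !mulr_ge0 ?exprn_ge0 //; lra.
- exact: ltW.
- by apply: (le_trans l3); rewrite (ler_nat R 3); lia.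
Qed.
End ExpBounds.

(** * The two-point hypercontractive inequality *)

(** From j to j + 1 the left side is multiplied by (m-j)(2m-2j-1)/(j+1) and the right side by
    (m-j)(2m-1)/(j+1). This is the source of the factor 2m - 1 in the hypercontractive constant. *)
Lemma bin_double_odd_fact m j :
  ('C(2 * m, 2 * j) * odd_fact j <= 'C(m, j) * (2 * m - 1) ^ j)%N.
Proof.
elim: j => [|j IH]; first by rewrite muln0 !bin0 /odd_fact big_ord0 expn0.
have [mj|jm] := leqP m j; first by rewrite bin_small // mulnS; lia.
have h3 := mul_bin_left (2 * m) (2 * j).
have h2 := mul_bin_left (2 * m) (2 * j).+1.
have h1 := mul_bin_left m j.
rewrite odd_factS expnS (_ : 2 * j.+1 = (2 * j).+2)%N; last by lia.
move: h1 h2 h3 IH.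
move: ('C(m, j)) ('C(m, j.+1)) ('C(2 * m, (2 * j).+2)) => A A' c.
move: ('C(2 * m, (2 * j).+1)) ('C(2 * m, 2 * j)) => b a.
move: (odd_fact j) ((2 * m - 1) ^ j)%N => D P h1 h2 h3 IH.
rewrite -(leq_pmul2l (isT : 0 < 2)%N) -(leq_pmul2l (ltn0Sn j)).
have -> : (j.+1 * (2 * (c * (D * (2 * j + 1)))) =
    (2 * m - (2 * j).+1) * (2 * m - 2 * j) * (a * D))%N.
  have -> : (j.+1 * (2 * (c * (D * (2 * j + 1)))) =
    ((2 * j).+2 * c) * ((2 * j).+1 * D))%N by lia.
  rewrite h2 -[LHS]mulnA [X in (_ * X)%N]mulnA [X in (_ * (X * _))%N]mulnC h3.
  by rewrite !mulnA.
have -> : (j.+1 * (2 * (A' * ((2 * m - 1) * P))) =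
    (2 * m - 1) * (2 * m - 2 * j) * (A * P))%N.
  have -> : (j.+1 * (2 * (A' * ((2 * m - 1) * P))) =
    (2 * m - 1) * 2 * P * (j.+1 * A'))%N by lia.
  by rewrite h1 -mulnBr; lia.
by apply: leq_mul => //; apply: leq_mul => //; lia.
Qed.

Lemma sum_even_indices (F : nmodType) (a : nat -> F) m :
  (forall i, odd i -> a i = 0) ->
  \sum_(i < (2 * m).+1) a i = \sum_(j < m.+1) a (2 * j)%N.
Proof.
move=> a0; elim: m => [|m IH]; first by rewrite !big_ord_recr !big_ord0.
rewrite (_ : (2 * m.+1).+1 = (2 * m).+3)%N; last by lia.
rewrite 2!big_ord_recr /= IH [RHS]big_ord_recr /= a0 ?addr0; last first.
  by rewrite /= oddM.
by rewrite (_ : (2 * m).+2 = 2 * m.+1)%N //; lia.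
Qed.

Lemma exprD_even_part (F : comPzRingType) (u y : F) m :
  (u + y) ^+ (2 * m) + (u - y) ^+ (2 * m) =
  \sum_(j < m.+1) 2 * ('C(2 * m, 2 * j)%:R * ((u ^+ 2) ^+ (m - j) * (y ^+ 2) ^+ j)).
Proof.
rewrite !exprDn -big_split /=.
rewrite (eq_bigr (fun i : 'I_(2 * m).+1 =>
   (if odd i then 0 else 2) * ('C(2 * m, i)%:R * (u ^+ (2 * m - i) * y ^+ i)))).
  rewrite (@sum_even_indices _ (fun i : nat => (if odd i then 0 else 2) *
     ('C(2 * m, i)%:R * (u ^+ (2 * m - i) * y ^+ i)))).
    by apply: eq_bigr => j _; rewrite oddM /= -mulnBr !exprM.
  by move=> i ->; rewrite mul0r.
move=> i _; rewrite exprNn -signr_odd; case: (odd i).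
  by rewrite expr1 mulN1r mulrN mulNrn subrr mul0r.
by rewrite expr0 mul1r -mulr_natl; ring.
Qed.

Lemma sqrt_odds (R : realType) (p : R) : 0 < p -> p < 1 ->
  Num.sqrt ((1 - p) / p) = Num.sqrt (p * (1 - p)) / p.
Proof.
move=> p0 p1.
have -> : (1 - p) / p = (Num.sqrt (p * (1 - p)) / p) ^+ 2.
  rewrite expr_div_n sqr_sqrtr; last by apply: mulr_ge0; lra.
  by field; rewrite gt_eqF.
by rewrite sqrtr_sqr ger0_norm // divr_ge0 ?sqrtr_ge0 // ltW.
Qed.

Lemma sqrt_odds_inv (R : realType) (p : R) : 0 < p -> p < 1 ->
  Num.sqrt (p / (1 - p)) = Num.sqrt (p * (1 - p)) / (1 - p).
Proof.
move=> p0 p1.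
have -> : p / (1 - p) = (Num.sqrt (p * (1 - p)) / (1 - p)) ^+ 2.
  rewrite expr_div_n sqr_sqrtr; last by apply: mulr_ge0; lra.
  by field; rewrite gt_eqF //; lra.
by rewrite sqrtr_sqr ger0_norm // divr_ge0 ?sqrtr_ge0 //; lra.
Qed.

Lemma BconstC (R : realType) (p : R) : Bconst (1 - p) = Bconst p.
Proof.
rewrite /Bconst; have -> : (1 - p == 2^-1) = (p == 2^-1).
  by apply/eqP/eqP => h; lra.
case: eqP => // _; rewrite subKr.
rewrite -[ln p - _]opprB mulrN invrN mulrN -mulNr opprB; congr (_ / (_ * _)).
by ring.
Qed.

(** Symmetry under p -> 1 - p reduces to p <= 1/2. For p < 1/2, 2B(p)pq = 1/L and [log_mean_moment]
    applies; at p = 1/2 the quantity 2B(p)pq is 1/2 and the claim follows by induction. *)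
Lemma Bconst_moment (R : realType) (p : R) j :
  0 < p -> p < 1 -> (0 < j)%N ->
  0 < Bconst p /\
  2 * (p * (1 - p)) <= (odd_fact j)%:R * (2 * Bconst p * (p * (1 - p))) ^+ j.
Proof.
wlog p2 : p / p <= 2^-1 => [wl|] p0 p1 j0.
  have [p2|p2] := lerP p 2^-1; first exact: wl.
  have := wl (1 - p); rewrite BconstC subKr [_ * p]mulrC; apply=> //; lra.
move: p2; rewrite le_eqVlt => /orP[/eqP pE|p2].
  rewrite /Bconst pE eqxx; split=> //.
  rewrite (_ : 2 * (2^-1 * _) = 2^-1); last by field.
  rewrite (_ : 2 * 1 * _ = 2^-1); last by field.
  case: j j0 => // j _; elim: j => [|j IH]; first by rewrite odd_fact1 mul1r.
  rewrite odd_factS natrM exprSr mulrACA; apply: (le_trans IH).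
  rewrite ler_peMr ?mulr_ge0 ?exprn_ge0 ?invr_ge0 //.
  by rewrite natrD natrM -[j.+1]addn1 natrD; have := ler0n R j; lra.
have q0 : 0 < 1 - 2 * p by lra.
have r1 : 1 < (1 - p) / p by rewrite ltr_pdivlMr //; lra.
have c0 : 0 < ln ((1 - p) / p) by rewrite ln_gt0.
have := log_mean_moment p0 p2 j0.
have BE : 2 * Bconst p * (p * (1 - p)) = (ln ((1 - p) / p) / (1 - 2 * p))^-1.
  rewrite /Bconst lt_eqF // -ln_div ?posrE //; last by lra.
  by field; rewrite !gt_eqF //; lra.
rewrite BE exprVn => h; split.
  have : 0 < 2 * Bconst p * (p * (1 - p)) by rewrite BE invr_gt0 divr_gt0.
  rewrite pmulr_lgt0; last by rewrite mulr_gt0 //; lra.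
  by rewrite pmulr_rgt0.
by rewrite ler_pdivlMr ?exprn_gt0 ?divr_gt0 // mulrA.
Qed.

(** After symmetrization only even powers of v survive, and they are compared one by one with the
    binomial expansion of the right side. *)
Lemma two_point (R : realType) (p u v : R) m :
  0 < p -> p < 1 -> (0 < m)%N ->
  p * (u + Num.sqrt ((1 - p) / p) * v) ^+ (2 * m) +
    (1 - p) * (u - Num.sqrt (p / (1 - p)) * v) ^+ (2 * m) <=
  (u ^+ 2 + 2 * Bconst p * (2 * m - 1)%:R * v ^+ 2) ^+ m.
Proof.
move=> p0 p1 m0; rewrite sqrt_odds // sqrt_odds_inv //.
set s := Num.sqrt _.
have pq0 : 0 < p * (1 - p) by rewrite mulr_gt0 //; lra.
have s2 : s ^+ 2 = p * (1 - p) by rewrite sqr_sqrtr // ltW.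
have s0 : 0 < s by rewrite sqrtr_gt0.
pose y := s^-1 * v.
(* Symmetrization: with X' an independent copy of omega_i, u + omega_i v is the
   average over X' of u + (omega_i - X') v. *)
have jensen (a b : R) :
    (p * a + (1 - p) * b) ^+ (2 * m) <= p * a ^+ (2 * m) + (1 - p) * b ^+ (2 * m).
  pose w (c : bool) := if c then p else 1 - p.
  have := @jensen_pow R bool w (fun c => if c then a else b) (2 * m).-1.
  rewrite !big_bool /= prednK; last by lia.
  rewrite -!normrX !exprM !(ger0_norm (exprn_ge0 _ (sqr_ge0 _))) => h.
  apply: le_trans (h _ _); last 2 first.
  - by case; rewrite /w; lra.
  - by lra.
  apply: lerXn2r; rewrite ?nnegrE ?sqr_ge0 // -ler_sqrt ?sqr_ge0 // !sqrtr_sqr.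
  apply: le_trans (ler_norm _); apply: le_trans (ler_normD _ _) _.
  rewrite !normrM [`|p|]ger0_norm ?[`|1 - p|]ger0_norm //; lra.
have e1 : u + s / p * v = p * u + (1 - p) * (u + y).
  rewrite /y (_ : s^-1 = s / (p * (1 - p))); last first.
    by rewrite -s2; field; rewrite gt_eqF.
  by field; rewrite !gt_eqF //; lra.
have e0 : u - s / (1 - p) * v = p * (u - y) + (1 - p) * u.
  rewrite /y (_ : s^-1 = s / (p * (1 - p))); last first.
    by rewrite -s2; field; rewrite gt_eqF.
  by field; rewrite !gt_eqF //; lra.
(* The difference of two independent copies is 0 with probability p^2 + q^2 and each of 1/s, -1/s
   with probability pq; y = v/s. *)
apply: (@le_trans _ _ ((p ^+ 2 + (1 - p) ^+ 2) * u ^+ (2 * m) +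
   p * (1 - p) * ((u + y) ^+ (2 * m) + (u - y) ^+ (2 * m)))).
  rewrite e1 e0; have := jensen u (u + y); have := jensen (u - y) u.
  have q0 : 0 <= 1 - p by lra.
  by move=> /(ler_wpM2l q0) h1 /(ler_wpM2l (ltW p0)) h2; lra.
rewrite exprD_even_part [leRHS]exprDn big_ord_recl [in leRHS]big_ord_recl /=.
rewrite muln0 !bin0 subn0 !expr0 !mulr1 mul1r mulr1n exprM mulrDr addrA.
(* The terms free of v agree because p^2 + q^2 + 2pq = 1. *)
apply: lerD; first by rewrite le_eqVlt; apply/orP; left; apply/eqP; ring.
rewrite mulr_sumr; apply: ler_sum => j _.
rewrite /bump /= !add1n; move: (j : nat) => i.
have [B0 Bm] := Bconst_moment p0 p1 (ltn0Sn i).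
have := bin_double_odd_fact m i.+1; rewrite -(ler_nat R) !natrM natrX => bd.
have yE : (y ^+ 2) ^+ i.+1 = (v ^+ 2) ^+ i.+1 / (p * (1 - p)) ^+ i.+1.
  rewrite -expr_div_n -s2 /y; congr (_ ^+ _).
  by field; rewrite gt_eqF.
have UV0 : 0 <= (u ^+ 2) ^+ (m - i.+1) * (v ^+ 2) ^+ i.+1.
  by apply: mulr_ge0; apply: exprn_ge0; exact: sqr_ge0.
have -> : (2 * Bconst p * (2 * m - 1)%:R * v ^+ 2) ^+ i.+1 =
    (2 * Bconst p) ^+ i.+1 * (2 * m - 1)%:R ^+ i.+1 * (v ^+ 2) ^+ i.+1.
  by rewrite -!exprMn.
rewrite yE -[leRHS]mulr_natl; move: UV0; set U := _ ^+ (m - _); set V := (v ^+ 2) ^+ _.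
move=> UV0; set Q := (p * (1 - p)) ^+ i.+1; rewrite exprMn -/Q in Bm.
have Q0 : 0 < Q by rewrite exprn_gt0.
move: Bm bd; set b := (2 * Bconst p) ^+ _; set M := _%:R ^+ _ => Bm bd.
have b0 : 0 <= b by rewrite exprn_ge0 // mulr_ge0 // ltW.
rewrite [leRHS](_ : _ = 'C(m, i.+1)%:R * M * b * (U * V)); last by ring.
(* The coefficient 2pq C(2m,2j)/(pq)^j, with j = i + 1, is handled by multiplying [bd], which
   supplies (2m-1)^j, by [Bm], which supplies (2B(p))^j; the double factorials cancel. *)
apply: le_trans (ler_wpM2r UV0 (ler_wpM2r b0 bd)).
rewrite [leLHS](_ : _ = 'C(2 * m, 2 * i.+1)%:R * (2 * (p * (1 - p)) / Q) * (U * V)).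
  rewrite ler_wpM2r // -[leRHS]mulrA ler_wpM2l // ler_pdivrMr //.
  by rewrite -mulrA.
by ring.
Qed.

(** * Fourier analysis and hypercontractivity on the biased cube *)

Definition bern (R : realType) (p : R) (b : bool) : R := if b then p else 1 - p.

Definition omega_val (R : realType) (p : R) (b : bool) : R :=
  if b then Num.sqrt ((1 - p) / p) else - Num.sqrt (p / (1 - p)).

Definition chaos (R : realType) (p : R) (n : nat) (a : {set 'I_n} -> R)
  (x : cube n) : R := \sum_T a T * omega p T x.

Section Cube.
Variables (R : realType) (p : R) (n : nat).
Hypotheses (p0 : 0 < p) (p1 : p < 1).
Implicit Types (x : cube n) (i : 'I_n) (S T A : {set 'I_n}).

Let q0 : 0 < 1 - p. Proof. by rewrite subr_gt0. Qed.

Lemma pmeasE x : pmeas p x = \prod_i bern p (x i).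
Proof.
apply: eq_bigr => i _; rewrite /bern; case: (x i) => /=.
  by rewrite expr1 subnn expr0 mulr1.
by rewrite expr0 mul1r subn0 expr1.
Qed.

Lemma pmeas_ge0 x : 0 <= pmeas p x.
Proof.
rewrite pmeasE; apply: prodr_ge0 => i _.
by rewrite /bern; case: (x i); apply: ltW.
Qed.

Lemma expect_prod (phi : 'I_n -> bool -> R) :
  expect p (fun x => \prod_i phi i (x i)) =
  \prod_i (p * phi i true + (1 - p) * phi i false).
Proof.
have -> : \prod_i (p * phi i true + (1 - p) * phi i false) =
    \prod_i \sum_b bern p b * phi i b.
  by apply: eq_bigr => i _; rewrite big_bool.
rewrite bigA_distr_bigA /=; apply: eq_bigr => x _.
by rewrite pmeasE -big_split.
Qed.

Lemma pmeas_sum : \sum_(x : cube n) pmeas p x = 1.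
Proof.
transitivity (expect p (fun x : cube n => \prod_(i < n) 1)).
  by apply: eq_bigr => x _; rewrite big1 ?mulr1.
by rewrite (expect_prod (fun _ _ => 1)) big1 // => i _; rewrite !mulr1 subrKC.
Qed.

Lemma expectD (g h : cube n -> R) :
  expect p (fun x => g x + h x) = expect p g + expect p h.
Proof. by rewrite /expect -big_split /=; apply: eq_bigr => x _; rewrite mulrDr. Qed.

Lemma expectZ (c : R) (h : cube n -> R) :
  expect p (fun x => c * h x) = c * expect p h.
Proof. by rewrite /expect mulr_sumr; apply: eq_bigr => x _; rewrite mulrCA. Qed.

Lemma expect_sum (I : finType) (h : I -> cube n -> R) :
  expect p (fun x => \sum_i h i x) = \sum_i expect p (h i).
Proof. by rewrite /expect exchange_big; apply: eq_bigr => x _; rewrite mulr_sumr. Qed.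

Lemma ler_expect (g h : cube n -> R) :
  (forall x, g x <= h x) -> expect p g <= expect p h.
Proof.
by move=> gh; apply: ler_sum => x _; rewrite ler_wpM2l ?pmeas_ge0.
Qed.

Lemma flipK i : involutive (@flip n i).
Proof.
move=> x; apply/ffunP => j; rewrite !ffunE; case: eqP => // _.
by rewrite negbK.
Qed.

Lemma flip_same i x : flip i x i = ~~ x i.
Proof. by rewrite ffunE eqxx. Qed.

Lemma omega1E i x : omega1 p i x = omega_val p (x i).
Proof. by []. Qed.

Lemma omega_flip i T x : i \notin T -> omega p T (flip i x) = omega p T x.
Proof.
move=> iT; apply: eq_bigr => j jT; rewrite !omega1E ffunE.
by case: eqP => // ji; rewrite -ji jT in iT.
Qed.

(** Averaging over coordinate i with the others fixed. Writing it through [flip i x] keeps the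
    argument on one cube, with no passage to a lower dimension. *)
Lemma expect_resample i (h : cube n -> R) :
  expect p h =
  expect p (fun x => bern p (x i) * h x + bern p (~~ x i) * h (flip i x)).
Proof.
pose nu x := \prod_(j | j != i) bern p (x j).
have pE x : pmeas p x = bern p (x i) * nu x by rewrite pmeasE (bigD1 i).
have nuF x : nu (flip i x) = nu x.
  by apply: eq_bigr => j /negbTE ji; rewrite ffunE ji.
rewrite [RHS]/expect; under eq_bigr => x _ do rewrite mulrDr.
rewrite big_split /= [X in _ + X](reindex_inj (inv_inj (flipK i))) /=.
rewrite -big_split /=; apply: eq_bigr => x _.
rewrite flipK flip_same negbK !pE nuF flip_same.
have : bern p (x i) + bern p (~~ x i) = 1 by rewrite /bern; case: (x i) => /=; lra.
move=> h1; rewrite -[LHS]mulr1 -h1; ring.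
Qed.

Let s := Num.sqrt (p * (1 - p)).

Lemma bern_omega_val b : bern p b * omega_val p b = if b then s else - s.
Proof.
rewrite /bern /omega_val; case: b.
  by rewrite sqrt_odds // mulrC divfK // gt_eqF.
by rewrite sqrt_odds_inv // mulrN mulrC divfK // gt_eqF.
Qed.

Lemma omega_val_mean : p * omega_val p true + (1 - p) * omega_val p false = 0.
Proof.
have := bern_omega_val true; have := bern_omega_val false.
by rewrite /bern => -> ->; rewrite subrr.
Qed.

Lemma omega_val_sqr b : omega_val p b ^+ 2 = bern p (~~ b) / bern p b.
Proof.
rewrite /bern /omega_val; case: b => /=; rewrite ?sqrrN sqr_sqrtr //.
  by rewrite divr_ge0 // ltW.
by rewrite divr_ge0 // ltW.
Qed.

Lemma omega_orthonormal S T :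
  expect p (fun x => omega p S x * omega p T x) = (S == T)%:R.
Proof.
pose phi i (b : bool) := (if i \in S then omega_val p b else 1) *
  (if i \in T then omega_val p b else 1).
transitivity (expect p (fun x => \prod_i phi i (x i))).
  apply: eq_bigr => x _; congr (_ * _).
  by rewrite /omega big_mkcond [X in _ * X]big_mkcond -big_split.
rewrite expect_prod.
have [eST|ST] := eqVneq S T.
  rewrite big1 // => i _; rewrite /phi -eST; case: (i \in S); last by lra.
  by rewrite -!expr2 !omega_val_sqr /bern /=; field; rewrite !gt_eqF.
have /existsP[i Hi] : [exists i, (i \in S) != (i \in T)].
  apply: contraNT ST => /existsPn h.
  by apply/eqP/setP => i; have := h i; rewrite negbK => /eqP.
rewrite (bigD1 i) //=; suff -> : p * phi i true + (1 - p) * phi i false = 0.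
  by rewrite mul0r.
by move: Hi; rewrite /phi; case: (i \in S); case: (i \in T) => // _;
  rewrite ?mulr1 ?mul1r omega_val_mean.
Qed.

Lemma chaos_inner (a b : {set 'I_n} -> R) :
  expect p (fun x => chaos p a x * chaos p b x) = \sum_T a T * b T.
Proof.
transitivity (\sum_S \sum_T a S * b T * (S == T)%:R).
  rewrite /chaos; transitivity (expect p (fun x =>
     \sum_S \sum_T a S * b T * (omega p S x * omega p T x))).
    apply: eq_bigr => x _; congr (_ * _); rewrite mulr_suml.
    apply: eq_bigr => S _; rewrite mulr_sumr; apply: eq_bigr => T _; ring.
  rewrite expect_sum; apply: eq_bigr => S _.
  rewrite expect_sum; apply: eq_bigr => T _.
  by rewrite expectZ omega_orthonormal.
apply: eq_bigr => S _; rewrite (bigD1 S) //= eqxx mulr1 big1 ?addr0 // => T.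
by rewrite eq_sym => /negbTE ->; rewrite mulr0.
Qed.

Lemma sum_subset_split i A (F : {set 'I_n} -> R) : i \in A ->
  \sum_(T : {set 'I_n} | T \subset A) F T =
  \sum_(T : {set 'I_n} | T \subset A :\ i) F T + \sum_(T : {set 'I_n} | T \subset A :\ i) F (i |: T).
Proof.
move=> iA; rewrite (bigID (fun T : {set 'I_n} => i \notin T)) /=; congr (_ + _).
  by apply: eq_bigl => T; rewrite subsetD1.
rewrite (reindex_onto (fun T => i |: T) (fun T => T :\ i)); last first.
  by move=> T /andP[_]; rewrite negbK => iT; rewrite setD1K.
apply: eq_bigl => T; rewrite setU11 /= andbT subUset sub1set iA subsetD1 /=.
have [iT|iT] := boolP (i \in T).
  rewrite andbF; apply/andP => -[_ /eqP h].
  by move: iT; rewrite -h setD11.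
by rewrite setU1K // eqxx.
Qed.

(** Induction on the size of A. Split off one coordinate as u + omega_i v, apply [two_point] with
    the others fixed, separate u^2 and C v^2 by Minkowski in L^m, and use induction on u and v. The
    extra C accounts for the larger size of [i |: T]. *)
Lemma hypercontractivity m A (a : {set 'I_n} -> R) : (0 < m)%N ->
  expect p (fun x => (\sum_(T : {set 'I_n} | T \subset A) a T * omega p T x) ^+ (2 * m)) <=
  (\sum_(T : {set 'I_n} | T \subset A) (2 * Bconst p * (2 * m - 1)%:R) ^+ #|T| * a T ^+ 2) ^+ m.
Proof.
move=> m0; set C := 2 * _ * _.
have C0 : 0 <= C.
  by rewrite mulr_ge0 // mulr_ge0 // ltW //; case: (Bconst_moment p0 p1 (isT : 0 < 1)%N).
have [k Ak] := ubnP #|A|; elim: k => // k IH in A a Ak *.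
have [->|[i iA]] := set_0Vmem A.
  have e T : (T \subset set0) = (T == set0) by rewrite subset0.
  rewrite (eq_bigl _ _ e) big_pred1_eq cards0 expr0 mul1r -exprM.
  rewrite /expect; under eq_bigr => x _.
    rewrite (eq_bigl _ _ e) big_pred1_eq /omega big_set0 mulr1; over.
  by rewrite -mulr_suml pmeas_sum mul1r.
have Ak' : (#|A :\ i| < k)%N by move: Ak; rewrite (cardsD1 i A) iA.
pose u x := \sum_(T : {set 'I_n} | T \subset A :\ i) a T * omega p T x.
pose v x := \sum_(T : {set 'I_n} | T \subset A :\ i) a (i |: T) * omega p T x.
have iT T : T \subset A :\ i -> i \notin T by rewrite subsetD1 => /andP[].
have uF x : u (flip i x) = u x.
  by apply: eq_bigr => T /iT h; rewrite omega_flip.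
have vF x : v (flip i x) = v x.
  by apply: eq_bigr => T /iT h; rewrite omega_flip.
have fE x : \sum_(T : {set 'I_n} | T \subset A) a T * omega p T x =
    u x + omega_val p (x i) * v x.
  rewrite (sum_subset_split _ iA) /v mulr_sumr; congr (_ + _).
  by apply: eq_bigr => T /iT h; rewrite /omega big_setU1 //= mulrCA.
apply: (@le_trans _ _ (expect p (fun x => (u x ^+ 2 + C * v x ^+ 2) ^+ m))).
  rewrite (expect_resample i); apply: ler_expect => x.
  rewrite !fE uF vF flip_same; have := two_point (u x) (v x) p0 p1 m0.
  rewrite -/C /bern /omega_val; case: (x i) => /=; rewrite mulNr //.
  by rewrite [X in _ -> X <= _]addrC.
rewrite (sum_subset_split _ iA).
apply: minkowski_pow => //.
- exact: pmeas_ge0.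
- by move=> x; exact: sqr_ge0.
- by move=> x; rewrite mulr_ge0 // sqr_ge0.
- by apply: sumr_ge0 => T _; rewrite mulr_ge0 ?sqr_ge0 ?exprn_ge0.
- by apply: sumr_ge0 => T _; rewrite mulr_ge0 ?sqr_ge0 ?exprn_ge0.
- by under eq_bigr => x _ do rewrite -exprM; exact: IH.
have -> : \sum_(T : {set 'I_n} | T \subset A :\ i) C ^+ #|i |: T| * a (i |: T) ^+ 2 =
    C * \sum_(T : {set 'I_n} | T \subset A :\ i) C ^+ #|T| * a (i |: T) ^+ 2.
  rewrite mulr_sumr; apply: eq_bigr => T /iT h.
  by rewrite cardsU1 h add1n exprS mulrA.
rewrite exprMn; under eq_bigr => x _ do rewrite exprMn mulrCA -exprM.
rewrite -mulr_sumr ler_wpM2l ?exprn_ge0 //; exact: IH.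
Qed.
End Cube.

(* Fourier coefficients of x |-> E[f omega_i | coordinates outside I]. *)
Definition link_coef (R : realType) (p : R) (n : nat) (f : cube n -> bool)
    (I : {set 'I_n}) (i : 'I_n) (T : {set 'I_n}) : R :=
  if T \subset ~: I then fourier p f (i |: T) else 0.

Definition level (R : realType) (n k : nat) (a : {set 'I_n} -> R)
    (T : {set 'I_n}) : R := if #|T| == k then a T else 0.

(* Reproducing kernel of conditional expectation on the coordinates in J. *)
Definition cond_kernel (R : realType) (p : R) (n : nat) (J : {set 'I_n})
    (x y : cube n) : R :=
  \sum_(T : {set 'I_n} | T \subset J) omega p T x * omega p T y.

(** * The functions F_i: L1 bound and level-k estimates *)

Section Link.
Variables (R : realType) (p : R) (n : nat).
Hypotheses (p0 : 0 < p) (p1 : p < 1).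
Implicit Types (x y : cube n) (i : 'I_n) (I J T : {set 'I_n}) (f : cube n -> bool).

(** The kernel factors as the product over j in J of 1 + omega_j(x) omega_j(y); a factor is 0 when x
    and y differ at j, and 1 plus a square otherwise. *)
Lemma cond_kernel_ge0 J x y : 0 <= cond_kernel p J x y.
Proof.
pose F j := if j \in J then omega1 p j x * omega1 p j y else 0.
have -> : cond_kernel p J x y = \prod_j (F j + 1).
  rewrite bigA_distr /cond_kernel big_mkcond /=; apply: eq_bigr => T _.
  rewrite -big_mkcond /=; case: ifP => [/subsetP TJ|/negbT/subsetPn[j jT jJ]].
    rewrite /omega -big_split /=; apply: eq_bigr => j jT.
    by rewrite /F TJ.
  by rewrite (bigD1 j) //= /F (negbTE jJ) mul0r.
apply: prodr_ge0 => j _; rewrite /F; case: ifP => _; last by rewrite add0r.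
rewrite /omega1 sqrt_odds // sqrt_odds_inv //.
have s2 : Num.sqrt (p * (1 - p)) ^+ 2 = p * (1 - p).
  by rewrite sqr_sqrtr // mulr_ge0 ?subr_ge0 // ltW.
have q0 : 0 < 1 - p by rewrite subr_gt0.
case: (x j); case: (y j).
- by rewrite addr_ge0 // -expr2 sqr_ge0.
- rewrite mulrN mulf_div -expr2 s2 divff ?addNr // mulf_neq0 // gt_eqF //.
- rewrite mulNr mulf_div [_ * p]mulrC -expr2 s2 divff ?addNr //.
  by rewrite mulf_neq0 // gt_eqF.
- by rewrite addr_ge0 // mulrNN -expr2 sqr_ge0.
Qed.

Lemma expect_cond_kernel J x : expect p (fun y => cond_kernel p J x y) = 1.
Proof.
pose a T := if T \subset J then omega p T x else 0.
pose b T : R := (T == set0)%:R.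
have -> : expect p (fun y => cond_kernel p J x y) =
    expect p (fun y => chaos p a y * chaos p b y).
  apply: eq_bigr => y _; congr (_ * _).
  have -> : chaos p b y = 1.
    rewrite /chaos (bigD1 set0) //= /b eqxx mul1r big1 ?addr0.
      by rewrite /omega big_set0.
    by move=> T /negbTE ->; rewrite mul0r.
  rewrite mulr1 /cond_kernel big_mkcond; apply: eq_bigr => T _.
  by rewrite /a; case: ifP => // _; rewrite mul0r.
rewrite chaos_inner // (bigD1 set0) //= /a /b sub0set eqxx mulr1 big1.
  by rewrite addr0 /omega big_set0.
by move=> T /negbTE ->; rewrite mulr0.
Qed.

Lemma expect_fourier f (a : {set 'I_n} -> R) :
  expect p (fun x => (f x)%:R * chaos p a x) = \sum_T a T * fourier p f T.
Proof.
transitivity (expect p (fun x => \sum_T a T * ((f x)%:R * omega p T x))).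
  apply: eq_bigr => x _; congr (_ * _); rewrite mulr_sumr.
  by apply: eq_bigr => T _; rewrite mulrCA.
by rewrite expect_sum; apply: eq_bigr => T _; rewrite expectZ.
Qed.

(** Expand E(f - h)^2 >= 0 for the Fourier sum h of f; E f^2 <= 1 since f is Boolean. *)
Lemma fourier_bessel f : \sum_T fourier p f T ^+ 2 <= 1.
Proof.
pose h x := chaos p (fourier p f) x.
have : 0 <= expect p (fun x => ((f x)%:R - h x) ^+ 2).
  by apply: sumr_ge0 => x _; rewrite mulr_ge0 ?sqr_ge0 // pmeas_ge0.
have -> : expect p (fun x => ((f x)%:R - h x) ^+ 2) =
   expect p (fun x => (f x)%:R ^+ 2) +
   (-2 * expect p (fun x => (f x)%:R * h x) + expect p (fun x => h x * h x)).
  rewrite -expectZ -!expectD; apply: eq_bigr => x _; congr (_ * _); ring.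
rewrite expect_fourier chaos_inner //.
have : expect p (fun x => (f x)%:R ^+ 2) <= 1.
  apply: (@le_trans _ _ (\sum_(x : cube n) pmeas p x)); last by rewrite pmeas_sum.
  apply: ler_sum => x _.
  by rewrite ler_piMr ?pmeas_ge0 // expr2 -natrM mulnb andbb lern1 leq_b1.
under [X in _ + (_ * X + X)]eq_bigr => T _ do rewrite -expr2.
by lra.
Qed.

(** F_i(y) is the mean over x of f omega_i K(x,y), and K ignores coordinate i. Averaging over that
    coordinate turns f omega_i into sqrt(pq) times a signed difference of f along i; since K is
    nonnegative with mean one, integrating over y gives the influence. *)
Lemma link_coef_l1 f I i : i \in I ->
  expect p (fun y => `|chaos p (link_coef p f I i) y|) <= influence' p f i.
Proof.
move=> iI; pose K := cond_kernel p (~: I).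
pose s := Num.sqrt (p * (1 - p)).
pose D x : R := s * (f x != f (flip i x))%:R.
have KF x y : K (flip i x) y = K x y.
  apply: eq_bigr => T TI; rewrite omega_flip //.
  by apply/negP => /(subsetP TI); rewrite inE iI.
have FE y : chaos p (link_coef p f I i) y =
    expect p (fun x => (f x)%:R * omega_val p (x i) * K x y).
  transitivity (expect p (fun x => \sum_(T : {set 'I_n})
      (if T \subset ~: I then omega p T y else 0) * ((f x)%:R * omega p (i |: T) x))).
    rewrite expect_sum; apply: eq_bigr => T _; rewrite expectZ mulrC /link_coef.
    by case: ifP => // _; rewrite mulr0 mul0r.
  apply: eq_bigr => x _; congr (_ * _).
  rewrite /K /cond_kernel mulr_sumr [RHS]big_mkcond; apply: eq_bigr => T _.
  case: ifP => [TI|_]; last by rewrite mul0r.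
  rewrite /omega big_setU1 /=; last first.
    by apply/negP => /(subsetP TI); rewrite inE iI.
  by rewrite omega1E; ring.
have Fle y : `|chaos p (link_coef p f I i) y| <= expect p (fun x => D x * K x y).
  rewrite FE (expect_resample _ i); apply: le_trans (ler_norm_sum _ _ _) _.
  apply: ler_sum => x _; rewrite normrM ger0_norm ?pmeas_ge0 //.
  rewrite ler_wpM2l ?pmeas_ge0 // KF flip_same.
  rewrite (_ : _ + _ = (bern p (x i) * omega_val p (x i) * (f x)%:R +
    bern p (~~ x i) * omega_val p (~~ x i) * (f (flip i x))%:R) * K x y); last by ring.
  rewrite normrM (ger0_norm (cond_kernel_ge0 _ _ _)).
  rewrite ler_wpM2r ?cond_kernel_ge0 // !bern_omega_val // /D -/s.
  have s0 : 0 <= s by rewrite sqrtr_ge0.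
  by case: (x i); case: (f x); case: (f (flip i x)) => /=;
    rewrite ?mulr1 ?mulr0 ?addr0 ?add0r ?subrr ?addNr ?normr0 ?normrN ?ger0_norm.
apply: le_trans (ler_expect p0 p1 Fle) _.
rewrite /expect; under eq_bigr => y _ do rewrite mulr_sumr.
rewrite exchange_big /=.
have e x : \sum_y pmeas p y * (pmeas p x * (D x * K x y)) = pmeas p x * D x.
  rewrite -[RHS]mulr1 -(expect_cond_kernel (~: I) x) /expect mulr_sumr.
  by apply: eq_bigr => y _; rewrite /K; ring.
under eq_bigr => x _ do rewrite e.
rewrite /influence' /influence /prob -/s mulr_sumr [leRHS]big_mkcond.
apply: ler_sum => x _; rewrite /D; case: ifP => _ /=.
  by rewrite mulr1 mulrC.
by rewrite !mulr0.
Qed.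

Lemma influence'_ge0 f i : 0 <= influence' p f i.
Proof.
rewrite mulr_ge0 ?sqrtr_ge0 //.
by apply: sumr_ge0 => x _; exact: pmeas_ge0.
Qed.

Lemma hyper_const_ge0 m : 0 <= 2 * Bconst p * (2 * m - 1)%:R.
Proof.
have [B0 _] := Bconst_moment p0 p1 (isT : 0 < 1)%N.
by rewrite !mulr_ge0 // ltW.
Qed.

(** With H the level-k part of F_i, N = <F_i, H> = E H^2. Hölder bounds N^(2m) by the L1 and L2
    norms of F_i and E H^(2m), which is at most (C^k N)^m by hypercontractivity; then divide by
    N^m. *)
Lemma link_level_bound f I i k m : i \in I -> (0 < m)%N ->
  (\sum_T level k (link_coef p f I i) T ^+ 2) ^+ m <=
  (2 * Bconst p * (2 * m - 1)%:R) ^+ (k * m) *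
  (influence' p f i ^+ (2 * m - 2) * \sum_T link_coef p f I i T ^+ 2).
Proof.
move=> iI m0; set a := link_coef p f I i; set C := 2 * _ * _.
set phi := \sum_T a T ^+ 2; set N := \sum_T _.
have C0 : 0 <= C by exact: hyper_const_ge0.
have N0 : 0 <= N by apply: sumr_ge0 => T _; exact: sqr_ge0.
have phi0 : 0 <= phi by apply: sumr_ge0 => T _; exact: sqr_ge0.
pose F := chaos p a; pose H := chaos p (level k a).
have NE : N = expect p (fun x => F x * H x).
  rewrite chaos_inner //; apply: eq_bigr => T _; rewrite /level.
  by case: ifP => _; rewrite expr2 // !mulr0.
have phiE : \sum_x pmeas p x * F x ^+ 2 = phi.
  rewrite -[LHS]/(expect p (fun x => F x ^+ 2)).
  by rewrite -[LHS]/(expect p (fun x => F x * F x)) chaos_inner.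
have H2m : \sum_x pmeas p x * H x ^+ (2 * m) <= (C ^+ k * N) ^+ m.
  have := hypercontractivity p0 p1 [set: 'I_n] (level k a) m0.
  have e T : (T \subset [set: 'I_n]) = true by rewrite subsetT.
  rewrite (eq_bigl _ _ e) -/C.
  rewrite (_ : \sum_T _ = C ^+ k * N); last first.
    rewrite mulr_sumr; apply: eq_bigr => T _; rewrite /level.
    by case: eqP => [->|_] //; rewrite expr0n /= !mulr0.
  apply: le_trans; rewrite le_eqVlt; apply/orP; left; apply/eqP.
  apply: eq_bigr => x _; congr (_ * _ ^+ _).
  by apply: eq_bigl => T; rewrite e.
have I0 := influence'_ge0 f i.
have key : N ^+ (2 * m) <=
    influence' p f i ^+ (2 * m - 2) * phi * (C ^+ k * N) ^+ m.
  apply: (@le_trans _ _ ((\sum_x pmeas p x * (`|F x| * `|H x|)) ^+ (2 * m))).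
    rewrite NE; apply: lerXn2r; rewrite ?nnegrE -?NE //.
      by apply: sumr_ge0 => x _; rewrite mulr_ge0 ?pmeas_ge0 ?mulr_ge0.
    rewrite NE; apply: ler_sum => x _; rewrite ler_wpM2l ?pmeas_ge0 // -normrM.
    exact: ler_norm.
  apply: (le_trans (@lyapunov_holder _ _ _ F H m m0 (pmeas_ge0 p0 p1))).
  rewrite phiE; apply: ler_pM => //.
  - apply: mulr_ge0 => //; apply: exprn_ge0; apply: sumr_ge0 => x _.
    by rewrite mulr_ge0 // pmeas_ge0.
  - apply: sumr_ge0 => x _; rewrite mulr_ge0 ?pmeas_ge0 //.
    by rewrite exprM exprn_ge0 // sqr_ge0.
  - rewrite ler_wpM2r //; apply: lerXn2r; rewrite ?nnegrE //; last first.
      exact: link_coef_l1.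
    by apply: sumr_ge0 => x _; rewrite mulr_ge0 // pmeas_ge0.
have [NZ|Np] := eqVneq N 0.
  rewrite NZ expr0n (gtn_eqF m0) /= !mulr_ge0 ?exprn_ge0 //.
have Ngt : 0 < N ^+ m by rewrite exprn_gt0 // lt_def Np.
rewrite -(ler_pM2r Ngt) -exprD addnn -mul2n (le_trans key) //.
have -> : (C ^+ k * N) ^+ m = C ^+ (k * m) * N ^+ m by rewrite exprMn exprM.
by rewrite le_eqVlt; apply/orP; left; apply/eqP; ring.
Qed.

(** Cauchy-Schwarz and [link_level_bound] for f and g, compared after squaring to avoid roots. The
    geometric mean of the two energies is replaced by the arithmetic mean, which is additive in i
    and so can be summed by Bessel. *)
Lemma link_level_inner f g I i k m : i \in I -> (0 < m)%N ->
  `|\sum_T level k (link_coef p f I i) T * level k (link_coef p g I i) T| ^+ m <=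
  (2 * Bconst p * (2 * m - 1)%:R) ^+ (k * m) *
  ((influence' p f i * influence' p g i) ^+ (m - 1) *
  ((\sum_T link_coef p f I i T ^+ 2 + \sum_T link_coef p g I i T ^+ 2) / 2)).
Proof.
move=> iI m0; have hf := link_level_bound f k iI m0.
have hg := link_level_bound g k iI m0.
have hX := cauchy_schwarz_sum (level k (link_coef p f I i))
  (level k (link_coef p g I i)).
have a0 := influence'_ge0 f i; have b0 := influence'_ge0 g i.
move: hf hg hX; set C := _ ^+ (k * m).
set Nf := \sum_T level k (link_coef p f I i) T ^+ 2.
set Ng := \sum_T level k (link_coef p g I i) T ^+ 2.
set phi := \sum_T link_coef p f I i T ^+ 2.
set gam := \sum_T link_coef p g I i T ^+ 2.
move: a0 b0; set a := influence' p f i; set b := influence' p g i.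
move=> a0 b0 hf hg hX; set X := \sum_T _.
have C0 : 0 <= C by rewrite exprn_ge0 // hyper_const_ge0.
have phi0 : 0 <= phi by apply: sumr_ge0 => T _; exact: sqr_ge0.
have gam0 : 0 <= gam by apply: sumr_ge0 => T _; exact: sqr_ge0.
have Nf0 : 0 <= Nf by apply: sumr_ge0 => T _; exact: sqr_ge0.
have Ng0 : 0 <= Ng by apply: sumr_ge0 => T _; exact: sqr_ge0.
have ab0 : 0 <= (a * b) ^+ (m - 1) by rewrite exprn_ge0 // mulr_ge0.
apply: (@ler_of_expr _ 2) => //.
  by rewrite !mulr_ge0 // ?invr_ge0 // addr_ge0.
have -> : (`|X| ^+ m) ^+ 2 = (X ^+ 2) ^+ m.
  by rewrite -!exprM mulnC !exprM real_normK ?num_real.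
apply: (@le_trans _ _ ((Nf * Ng) ^+ m)).
  by apply: lerXn2r => //; rewrite nnegrE ?sqr_ge0 ?mulr_ge0.
rewrite exprMn; apply: (@le_trans _ _ _ _ _ (ler_pM _ _ hf hg)).
- exact: exprn_ge0.
- exact: exprn_ge0.
have -> : (2 * m - 2 = (m - 1) * 2)%N by rewrite mulnBl mul1n mulnC.
rewrite !exprM.
have -> : C * ((a ^+ (m - 1)) ^+ 2 * phi) * (C * ((b ^+ (m - 1)) ^+ 2 * gam)) =
   (C * (a * b) ^+ (m - 1)) ^+ 2 * (phi * gam).
  by rewrite [(a * b) ^+ _]exprMn; ring.
rewrite [X in _ <= X ^+ 2]mulrA [leRHS]exprMn ler_wpM2l ?sqr_ge0 //.
have := sqr_ge0 (phi - gam); nra.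
Qed.
End Link.

(** * Averaging over a random set of coordinates *)

Section RandomPart.
Variables (R : realType) (n : nat).
Implicit Types (y : cube n) (i : 'I_n) (I T S : {set 'I_n}).

(** Random sets are encoded as points of the cube, so that [pmeas t] is the law of a set containing
    each coordinate independently with probability t. *)
Definition cube_set y : {set 'I_n} := [set i | y i].

Lemma prob_isolates (t : R) i T :
  \sum_(y : cube n) pmeas t y * (y i && (T \subset ~: cube_set y))%:R =
  if i \in T then 0 else t * (1 - t) ^+ #|T|.
Proof.
case: ifP => [iT|/negbT iT].
  rewrite big1 // => y _; case: andP => [[yi /subsetP /(_ _ iT)]|_].
    by rewrite !inE yi.
  by rewrite mulr0.
pose phi j (b : bool) : R :=
  if j == i then b%:R else if j \in T then (~~ b)%:R else 1.
transitivity (expect t (fun y : cube n => \prod_j phi j (y j))).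
  apply: eq_bigr => y _; congr (_ * _).
  have [/andP[yi /subsetP Ty]|] := boolP (_ && _).
    rewrite big1 // => j _; rewrite /phi; case: eqP => [->|_]; first by rewrite yi.
    by case: ifP => // /Ty; rewrite !inE => ->.
  rewrite negb_and => /orP[yi|/subsetPn[j jT]].
    by rewrite (bigD1 i) //= /phi eqxx (negbTE yi) mul0r.
  rewrite !inE negbK => yj; rewrite (bigD1 j) //= /phi yj jT.
  by case: eqP => [ji|_]; [rewrite -ji jT in iT | rewrite mul0r].
rewrite expect_prod (bigD1 i) //= /phi eqxx mulr1 mulr0 addr0; congr (_ * _).
rewrite -prodr_const (bigID (fun j => j \in T)) /= [X in _ * X]big1 ?mulr1.
  apply: eq_big => [j|j /andP[/negbTE -> ->]]; last by rewrite mulr0 add0r mulr1.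
  by case: eqP => // ->; rewrite (negbTE iT).
by move=> j /andP[/negbTE -> /negbTE ->]; rewrite !mulr1 subrKC.
Qed.

Lemma prob_coord (t : R) i : \sum_(y : cube n) pmeas t y * (y i)%:R = t.
Proof.
have := prob_isolates t i set0; rewrite inE cards0 expr0 mulr1 => h; rewrite -[RHS]h.
by apply: eq_bigr => y _; rewrite sub0set andbT.
Qed.

(** A set S = {i} u T with T disjoint from I meets I in {i} alone, so S determines i. No Fourier
    coefficient is counted twice, and Bessel applies. *)
Lemma sum_link_fourier_le1 (p : R) (f : cube n -> bool) I :
  0 < p -> p < 1 -> \sum_(i in I) \sum_T link_coef p f I i T ^+ 2 <= 1.
Proof.
move=> p0 p1; apply: le_trans (fourier_bessel p0 p1 f).
have e i : i \in I -> \sum_T link_coef p f I i T ^+ 2 =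
    \sum_(S : {set 'I_n} | S :&: I == [set i]) fourier p f S ^+ 2.
  move=> iI; rewrite [RHS](reindex_onto (fun T => i |: T) (fun S => S :\ i)) /=; last first.
    move=> S /eqP h; apply: setD1K.
    by have := set11 i; rewrite -h inE => /andP[].
  rewrite [RHS]big_mkcond; apply: eq_bigr => T _; rewrite /link_coef.
  case: ifP => [/subsetP TI|TI].
    have iT : i \notin T by apply/negP => /TI; rewrite inE iI.
    rewrite setU1K // eqxx andbT ifT //; apply/eqP/setP => j; rewrite !inE.
    case: eqP => [->|_] //=.
    by case: (boolP (j \in T)) => // /TI; rewrite inE => /negbTE.
  rewrite ifF ?expr0n //; apply/negP => /andP[/eqP h /eqP iT].
  move/negP: TI; apply; apply/subsetP => j jT; rewrite inE; apply/negP => jI.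
  have : j \in [set i] by rewrite -h !inE jT jI orbT.
  by rewrite inE => /eqP ji; move: jT; rewrite -iT ji setD11.
rewrite (eq_bigr _ e) (exchange_big_dep predT) //=; apply: ler_sum => S _.
rewrite sumr_const; set c := #|_|; suff : (c <= 1)%N.
  by case: c => [|[|//]] _; rewrite ?mulr0n ?mulr1n ?sqr_ge0.
apply/card_le1_eqP => i j; rewrite !unfold_in /=.
by move=> /andP[_ /eqP->] /andP[_]; rewrite eqEsubset sub1set inE => /andP[/eqP].
Qed.

(** Each S of size k + 1 arises from k + 1 pairs (i, S minus i). *)
Lemma sum_isolated_pairs (h : {set 'I_n} -> R) k :
  \sum_i \sum_(T : {set 'I_n} | (#|T| == k) && (i \notin T)) h (i |: T) =
  k.+1%:R * \sum_(S : {set 'I_n} | #|S| == k.+1) h S.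
Proof.
transitivity (\sum_i \sum_(S : {set 'I_n} | (#|S| == k.+1) && (i \in S)) h S).
  apply: eq_bigr => i _.
  rewrite [RHS](reindex_onto (fun T => i |: T) (fun S => S :\ i)); last first.
    by move=> S /andP[_ iS]; rewrite setD1K.
  apply: eq_bigl => T; rewrite setU11 andbT cardsU1.
  have [iT|iT] := boolP (i \in T).
    rewrite andbF; apply/esym/negP => /andP[_ /eqP TE].
    by move: iT; rewrite -TE setD11.
  by rewrite setU1K // eqxx !andbT.
rewrite (exchange_big_dep (fun S : {set 'I_n} => #|S| == k.+1)) /=; last first.
  by move=> i S _ /andP[].
rewrite mulr_sumr; apply: eq_bigr => S /eqP Sk.
rewrite (eq_bigl (mem S)) => [|i]; last by rewrite Sk eqxx.
by rewrite sumr_const Sk mulr_natl.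
Qed.

Lemma random_part_average (p t : R) (f g : cube n -> bool) k :
  \sum_(y : cube n) \sum_i pmeas t y * (y i)%:R *
    (\sum_T level k (link_coef p f (cube_set y) i) T *
            level k (link_coef p g (cube_set y) i) T) =
  t * (1 - t) ^+ k * (k.+1%:R *
    \sum_(S : {set 'I_n} | #|S| == k.+1) fourier p f S * fourier p g S).
Proof.
rewrite -sum_isolated_pairs exchange_big mulr_sumr /=; apply: eq_bigr => i _.
under eq_bigr => y _ do rewrite mulr_sumr.
rewrite exchange_big mulr_sumr [RHS]big_mkcond /=; apply: eq_bigr => T _.
rewrite /level; case: eqP => [Tk|_] /=; last first.
  by rewrite big1 // => y _; rewrite !mulr0.
rewrite -Tk; transitivity ((\sum_(y : cube n)
    pmeas t y * (y i && (T \subset ~: cube_set y))%:R) *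
    (fourier p f (i |: T) * fourier p g (i |: T))).
  rewrite mulr_suml; apply: eq_bigr => y _; rewrite /link_coef.
  case: ifP => _; first by rewrite andbT.
  by rewrite andbF !mulr0 mul0r.
by rewrite prob_isolates; case: ifP => //= _; rewrite mul0r.
Qed.

End RandomPart.

(** * The level-d bound and the choice of exponent *)

Section Level.
Variables (R : realType) (p : R) (n : nat) (f g : cube n -> bool).
Hypotheses (p0 : 0 < p) (p1 : p < 1).

Let W := \sum_(j < n) influence' p f j * influence' p g j.

(** Hölder over the pairs (I, i), weighted by Pr[I] when i is in I and by 0 otherwise: one factor
    carries the energies, of total at most 1, and m - 1 factors carry the influence products, of
    total W/(k+1). *)
Lemma level_inner_pow k m : (0 < m)%N ->
  `|(1 - k.+1%:R^-1) ^+ k *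
    \sum_(S : {set 'I_n} | #|S| == k.+1) fourier p f S * fourier p g S| ^+ m <=
  (2 * Bconst p * (2 * m - 1)%:R) ^+ (k * m) * (W / k.+1%:R) ^+ (m - 1).
Proof.
move=> m0; set C := (2 * _ * _) ^+ _; set Y := _ * \sum_(S | _) _.
 (* With this t the factor t(k+1) in [random_part_average] is 1. *)
 pose t : R := k.+1%:R^-1.
have t0 : 0 <= t by rewrite invr_ge0.
have t1 : t <= 1 by rewrite invf_le1 ?ltr0n // ler1n.
have mu0 (y : cube n) : 0 <= pmeas t y.
  by apply: prodr_ge0 => i _; rewrite mulr_ge0 ?exprn_ge0 ?subr_ge0.
have C0 : 0 <= C by rewrite exprn_ge0 // hyper_const_ge0.
pose w (z : cube n * 'I_n) := pmeas t z.1 * (z.1 z.2)%:R.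
have w0 z : 0 <= w z by rewrite mulr_ge0.
pose X (z : cube n * 'I_n) :=
  \sum_T level k (link_coef p f (cube_set z.1) z.2) T *
         level k (link_coef p g (cube_set z.1) z.2) T.
pose D (z : cube n * 'I_n) := (\sum_T link_coef p f (cube_set z.1) z.2 T ^+ 2 +
  \sum_T link_coef p g (cube_set z.1) z.2 T ^+ 2) / 2.
have D0 z : 0 <= D z.
  by rewrite divr_ge0 // addr_ge0 // sumr_ge0 // => T _; exact: sqr_ge0.
pose ab i := influence' p f i * influence' p g i.
have ab0 i : 0 <= ab i by rewrite mulr_ge0 // influence'_ge0.
have YE : Y = \sum_z w z * X z.
  rewrite -(pair_bigA _ (fun y i => w (y, i) * X (y, i))) /w /X /=.
  by rewrite random_part_average /Y /t [RHS]mulrACA mulVf ?mul1r // pnatr_eq0.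
have YX : `|Y| <= \sum_z w z * `|X z|.
  rewrite YE; apply: le_trans (ler_norm_sum _ _ _) _.
  by apply: ler_sum => z _; rewrite normrM (ger0_norm (w0 z)).
have Xm (z : cube n * 'I_n) : z.1 z.2 -> `|X z| ^+ m <= C * (ab z.2 ^+ (m - 1) * D z).
  by move=> zz; apply: link_level_inner => //; rewrite inE.
have SD : \sum_z w z * D z <= 1.
  rewrite -(pair_bigA _ (fun y i => w (y, i) * D (y, i))) /=.
  apply: (@le_trans _ _ (\sum_(y : cube n) pmeas t y)); last by rewrite pmeas_sum.
  apply: ler_sum => y _; rewrite /w /D /=.
  under eq_bigr => i _ do rewrite -mulrA.
  rewrite -mulr_sumr ler_piMr //.
  have := sum_link_fourier_le1 f (cube_set y) p0 p1.
  have := sum_link_fourier_le1 g (cube_set y) p0 p1.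
  rewrite [X in X <= 1 -> _]big_mkcond [X in _ -> X <= 1 -> _]big_mkcond /= => hg hf.
  apply: le_trans (_ : _ <= (1 + 1) / 2) _; last by lra.
  apply: le_trans (ler_wpM2r _ (lerD hf hg)); last by rewrite invr_ge0.
  rewrite -big_split /= mulr_suml; apply: ler_sum => i _; rewrite inE.
  by case: (y i); rewrite ?mul1r // mul0r addr0 mul0r.
have SA : \sum_z w z * ab z.2 = W / k.+1%:R.
  rewrite -(pair_bigA _ (fun y i => w (y, i) * ab i)) /= exchange_big /W mulr_suml.
  apply: eq_bigr => i _; rewrite -mulr_suml /w /= prob_coord mulrC.
  by [].
case: m m0 C C0 Xm => // m _ C C0 Xm; rewrite subn1 /= in Xm *.
pose A (j : 'I_m.+1) z := if j == ord0 then C * (w z * D z) else w z * ab z.2.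
apply: (@le_trans _ _ ((\sum_z w z * `|X z|) ^+ m.+1)).
  apply: lerXn2r => //; rewrite nnegrE //.
  by apply: sumr_ge0 => z _; rewrite mulr_ge0.
apply: (@le_trans _ _ (\prod_(j < m.+1) \sum_z A j z)).
  apply: generalized_holder => // [z|j z|z].
  - by rewrite mulr_ge0.
  - rewrite /A; case: ifP => _; last by apply: mulr_ge0; [exact: w0|exact: ab0].
    by apply: mulr_ge0 => //; apply: mulr_ge0; [exact: w0|exact: D0].
  rewrite big_ord_recl /A /= prodr_const card_ord.
  have [zz|zz] := boolP (z.1 z.2); last first.
    by rewrite /w (negbTE zz) !mulr0 !mul0r mulr0 mul0r expr0n.
  rewrite [leLHS]exprMn [(w z * ab z.2) ^+ m]exprMn.
  apply: le_trans (ler_wpM2l (exprn_ge0 _ (w0 z)) (Xm z zz)) _.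
  by rewrite exprS le_eqVlt; apply/orP; left; apply/eqP; ring.
rewrite big_ord_recl /A /= prodr_const card_ord SA -mulr_sumr.
rewrite ler_wpM2r ?ler_piMr //.
by rewrite exprn_ge0 // -SA sumr_ge0 // => z _; rewrite mulr_ge0.
Qed.
End Level.

(** The factor 2m - 1 grows with m and the exponential decreases; they balance near 2m = u. Taking m
    to be the floor of (u+1)/2 puts 2m within 1 of u, and the term -1 in 2m - 1 absorbs the
    rounding. *)
Lemma even_exponent_choice (R : realType) (u : R) : 3 <= u ->
  exists2 m : nat, (1 < m)%N &
    (2 * m - 1)%:R * expR (u / (2 * m%:R)) <= expR 1 * u.
Proof.
move=> u3; have u0 : 0 <= (u + 1) / 2 by lra.
have := truncn_itv u0; set m := Num.truncn _ => /andP[m1 m2].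
have mg : (1 < m)%N.
  by rewrite /m truncn_ge_nat //; lra.
exists m => //; have mR : 2 <= m%:R :> R by rewrite ler_nat.
move: m2; rewrite -[m.+1]addn1 natrD => m2.
rewrite natrB ?natrM; last by lia.
set v := u / (2 * m%:R).
have vE : v * (2 * m%:R) = u by rewrite divfK // gt_eqF //; lra.
have -> : expR 1 = expR v * expR (1 - v) by rewrite -expRD; congr expR; lra.
rewrite mulrC -mulrA ler_pM2l ?expR_gt0 //.
have h := expR_ge1Dx (1 - v).
have : 2 * m%:R - 1 <= (1 + (1 - v)) * u.
  (* At distance at most 1 from 2m, u(2 - u/2m) = 2m - (u - 2m)^2/2m. *)
  have : (u - 2 * m%:R) ^+ 2 <= 1 by nra.
  have : (1 + (1 - v)) * u * (2 * m%:R) = (2 * m%:R) ^+ 2 - (u - 2 * m%:R) ^+ 2.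
    by rewrite -vE; ring.
  nra.
move/le_trans; apply; rewrite ler_wpM2r //; lra.
Qed.

Theorem theorem7p3 (R : realType) (p : R) (n d : nat)
    (f g : cube n -> bool)
    (hp0 : 0 < p) (hp1 : p < 1) (hd : (2 <= d)%N)
    (hf : \sum_(j < n) influence' p f j ^+ 2 <= 1)
    (hg : \sum_(j < n) influence' p g j ^+ 2 <= 1)
    (hfg : \sum_(j < n) influence' p f j * influence' p g j
             <= expR (- (2 * (d%:R - 1)))) :
  \sum_(S : {set 'I_n} | #|S| == d) fourier p f S * fourier p g S
    <= 70 * expR 1 / d%:R
       * (4 * Bconst p * expR 1 / (d%:R - 1)) ^+ (d - 1)
       * (\sum_(j < n) influence' p f j * influence' p g j)
       * ln (d%:R / (\sum_(j < n) influence' p f j * influence' p g j)) ^+ (d - 1).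
Proof.
case: d hd hfg => [//|k]; rewrite ltnS => k0; rewrite subn1 /= -[k.+1]addn1 natrD addrK.
rewrite addn1; set W := \sum_(j < n) influence' p f j * _ => hfg.
set L := \sum_(S : {set 'I_n} | _) _.
have kR : 0 < k%:R :> R by rewrite ltr0n.
have [B0 _] := Bconst_moment hp0 hp1 (isT : 0 < 1)%N.
have W0 : 0 <= W by apply: sumr_ge0 => j _; rewrite mulr_ge0 // influence'_ge0.
have e0 := expR_gt0 (1 : R).
pose d : R := k%:R + 1.
have dE : k.+1%:R = d by rewrite -addn1 natrD.
have d0 : 0 < d by rewrite /d; lra.
pose c := (1 - d^-1) ^+ k.
have c0 : 0 < c by rewrite exprn_gt0 // subr_gt0 invf_lt1 // /d; lra.
(* (1 - 1/d)^(d-1) = (k/(k+1))^k >= 1/e. *)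
have ec : 1 <= expR 1 * c.
  rewrite /c (_ : 1 - d^-1 = k%:R / d); last by rewrite /d; field; rewrite gt_eqF.
  rewrite expr_div_n mulrA ler_pdivlMr ?exprn_gt0 // mul1r -dE.
  exact: succ_expr_le.
have key m : (0 < m)%N -> `|c * L| ^+ m <=
    (2 * Bconst p * (2 * m - 1)%:R) ^+ (k * m) * (W / d) ^+ (m - 1).
  by move=> m0; have := level_inner_pow f g hp0 hp1 k m0; rewrite dE.
(* When W = 0 the right side is 0 whatever value the logarithm takes, and [key] with m = 2, the
   first exponent to retain a factor W, forces L = 0. *)
have [WZ|Wn] := eqVneq W 0.
  rewrite WZ mulr0 mul0r; have := key 2 isT; rewrite WZ mul0r expr1 mulr0.
  rewrite real_normK ?num_real // => h.
  have : (c * L) ^+ 2 == 0 by rewrite eq_le h sqr_ge0.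
  by rewrite expf_eq0 /= mulf_eq0 gt_eqF //= => /eqP ->.
have {Wn} Wp : 0 < W by rewrite lt_def Wn.
pose l := ln (d / W).
have lE : expR l = d / W by rewrite lnK // posrE divr_gt0.
(* The hypothesis W <= exp(-2k) enters here; it makes u at least 4, enough for
   [even_exponent_choice]. *)
have l2k : 2 * k%:R <= l.
  rewrite -ler_expR lE ler_pdivlMr //.
  apply: (@le_trans _ _ (expR (2 * k%:R) * expR (- (2 * k%:R)))).
    by rewrite ler_pM2l ?expR_gt0.
  by rewrite -expRD subrr expR0 /d; lra.
pose u := 2 * l / k%:R.
have u3 : 3 <= u by rewrite ler_pdivlMr //; lra.
have [m m1 hm] := even_exponent_choice u3.
have m0 : (0 < m)%N by exact: ltnW.
have mR : 0 < m%:R :> R by rewrite ltr0n.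
(* G is the m-th root of the bound in [key]: since e^l = d/W, (W/d)^(1-1/m) = (W/d) e^(l/m). *)
pose G := (2 * Bconst p * (2 * m - 1)%:R) ^+ k * (W / d) * expR (l / m%:R).
have G0 : 0 <= G.
  rewrite mulr_ge0 ?expR_ge0 // mulr_ge0 ?exprn_ge0 ?hyper_const_ge0 //.
  by rewrite divr_ge0 // ltW.
have cLG : c * L <= G.
  apply: (ler_of_expr m0) => //; apply: (@le_trans _ _ (`|c * L| ^+ m)).
    by rewrite -normrX ler_norm.
  apply: (le_trans (key m m0)).
  have e (x y z : R) : (x * y * z) ^+ m = x ^+ m * (y ^+ m * z ^+ m).
    by rewrite !exprMn mulrA.
  rewrite /G e -exprM -expRM_natl (_ : m%:R * (l / m%:R) = l); last first.
    by field; rewrite gt_eqF.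
  rewrite lE ler_wpM2l ?exprn_ge0 ?hyper_const_ge0 //.
  rewrite -{2}(prednK m0) exprSr -mulrA subn1 (_ : W / d * (d / W) = 1).
    by rewrite mulr1.
  by field; rewrite !gt_eqF.
have LG : L <= expR 1 * G.
  have : c * L <= c * (expR 1 * G).
    by apply: (le_trans cLG); rewrite mulrA ler_peMl // mulrC.
  by rewrite ler_pM2l.
have GE : G <= W / d * (4 * Bconst p * expR 1 / k%:R * l) ^+ k.
  have Wd0 : 0 <= W / d by rewrite divr_ge0 // ltW.
  rewrite /G mulrAC [leLHS]mulrC ler_wpM2l //.
  (* As u = 2l/k, the loss e^(l/m) is a k-th power and combines with the hypercontractive factor, so
     [hm] applies inside the power. *)
  have -> : expR (l / m%:R) = expR (u / (2 * m%:R)) ^+ k.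
    by rewrite -expRM_natl; congr expR; rewrite /u; field; rewrite !gt_eqF.
  rewrite -exprMn; apply: lerXn2r; rewrite ?nnegrE.
  - by rewrite mulr_ge0 ?expR_ge0 // hyper_const_ge0.
  - rewrite !mulr_ge0 ?invr_ge0 //; lra.
  rewrite -[leLHS]mulrA [leRHS](_ : _ = 2 * Bconst p * (expR 1 * u)).
    by rewrite ler_pM2l // mulr_gt0.
  by rewrite /u; field; rewrite gt_eqF.
apply: (le_trans LG); rewrite -/d -/l.
rewrite exprMn in GE.
set Z := (_ / k%:R) ^+ k in GE *.
have ZL : 0 <= W / d * (Z * l ^+ k) by apply: le_trans GE.
rewrite (_ : 70 * _ / d * Z * W * l ^+ k = 70 * (expR 1 * (W / d * (Z * l ^+ k)))); last by ring.
(* The bound obtained has the constant e, and 70e follows by nonnegativity. *)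
apply: (@le_trans _ _ (expR 1 * (W / d * (Z * l ^+ k)))).
  by rewrite ler_pM2l.
by have := mulr_ge0 (ltW e0) ZL; lra.
Qed.
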